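(* Suppose $G$ is a graph with $k\ge 1$ pendant edges and maximum degree $\Delta(G)$. Then $\chi_{lt}(G)\ge \max\{\Delta(G)+1,\,k+1\}\ge 3$.
   Context: All graphs are finite, simple and loopless, of order $p=|V|\ge 3$ and size $q=|E|\ge 2$, with no isolated vertex and no $K_2$ component (graphs may be disconnected). A pendant vertex is a vertex of degree 1; a pendant edge is an edge incident to a pendant vertex. A local total antimagic labeling of $G=(V,E)$ is a bijection $f:V\cup E\to\{1,\dots,p+q\}$ such that, with weights $w_f(u)=\sum f(e)$ over all edges $e$ incident to $u$ for $u\in V$ (the label of $u$ itself is not included) and $w_f(uv)=f(u)+f(v)$ for $uv\in E$, one has: adjacent vertices have distinct weights, adjacent edges have distinct weights, and every vertex has a weight distinct from that of each of its incident edges. $\chi_{lt}(G)$ is the minimum, over all local total antimagic labelings $f$ of $G$, of the number of distinct values among all the vertex and edge weights (a lower bound on $\chi_{lt}(G)$ means that every local total antimagic labeling of $G$ has at least that many distinct weights). *)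

(* Defs.v *)
From HB Require Import structures.
From mathcomp Require Import all_boot.

Set Implicit Arguments.
Unset Strict Implicit.
Unset Printing Implicit Defensive.

Record sgraph := SGraph {
  vertex :> finType;
  adj : rel vertex;
  adj_sym : symmetric adj;
  adj_irrefl : irreflexive adj }.

Arguments adj {s} _ _.

Section Graph.
Variable G : sgraph.

Definition edges : {set {set G}} :=
  [set A : {set G} | [exists x, exists y, adj x y && (A == [set x; y])]].

Definition edge := {A : {set G} | A \in edges}.

(* By convention [u \in val a] says that the edge [a] is incident to [u]. *)

Definition deg (x : G) : nat := #|[set y | adj x y]|.

Definition max_deg : nat := \max_(x : G) deg x.

Definition no_isolated_vertex : Prop := forall x : G, deg x != 0.

Definition component (x : G) : {set G} := [set y | connect adj x y].

Definition no_K2_component : Prop :=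
  forall x y : G, adj x y -> component x != [set x; y].

Definition pendant_vertex (x : G) : bool := deg x == 1.

Definition pendant_edges : {set edge} :=
  [set a : edge | [exists x in val a, pendant_vertex x]].

(* Labelings and weights are functions on V + E. *)
Definition labeling : Type := (G + edge)%type -> nat.

Definition total_labeling (f : labeling) : Prop :=
  injective f /\
  forall n : nat,
    (1 <= n <= #|G| + #|edges|) <-> (exists z : (G + edge)%type, f z = n).

Definition weight (f : labeling) (z : (G + edge)%type) : nat :=
  match z with
  | inl u => \sum_(a : edge | u \in val a) f (inr a)
  | inr a => \sum_(u in val a) f (inl u)
  end.

Definition adjacent_edges (a b : edge) : bool :=
  (a != b) && ~~ [disjoint val a & val b].

Definition local_total_antimagic (f : labeling) : Prop :=
  [/\ total_labeling f,
      forall u v : G, adj u v -> weight f (inl u) <> weight f (inl v),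
      forall a b : edge,
        adjacent_edges a b -> weight f (inr a) <> weight f (inr b)
    & forall (u : G) (a : edge),
        u \in val a -> weight f (inl u) <> weight f (inr a)].

Definition num_weights (f : labeling) : nat := size (undup (codom (weight f))).

(* [is_chi_lt c] : the local total antimagic chromatic number exists and is
   [c].  It is a relation because a graph might have no local total antimagic
   labeling, in which case the minimum is over the empty set. *)
Definition is_chi_lt (c : nat) : Prop :=
  (exists2 f, local_total_antimagic f & num_weights f = c) /\
  (forall f, local_total_antimagic f -> c <= num_weights f).

(* [chi_lt >= b], with the minimum of the empty set read as +oo. *)
Definition chi_lt_ge (b : nat) : Prop :=
  forall f, local_total_antimagic f -> b <= num_weights f.

Lemma weight_edgeE (f : labeling) (a : edge) (u v : G) :
  adj u v -> val a = [set u; v] -> weight f (inr a) = f (inl u) + f (inl v).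
Proof.
move=> uv aE; rewrite /= aE big_setU1 ?big_set1 // inE.
by apply: contraL uv => /eqP ->; rewrite adj_irrefl.
Qed.

End Graph.

(* Main.v *)
Require Import Defs.
From mathcomp Require Import all_boot.

(** The edges at a vertex [u] of maximum degree have pairwise distinct weights,
all different from the weight of [u].  The weight of a pendant vertex is the
label of its edge, so the labels of the [k] pendant edges are [k] distinct
weights; the largest of them is exceeded by the weight of the non-pendant end
of that edge, which has another edge since there is no [K_2] component. *)

Section LowerBounds.
Variable G : sgraph.
Implicit Types (x y u : G) (a b : edge G) (f : labeling G).

Lemma edge_endP u a :
  u \in val a -> exists2 y, adj u y & val a = [set u; y].
Proof.
case: a => A /= AE uA; move: (AE); rewrite inE.
case/existsP=> x /existsP[y /andP[xy /eqP AE']].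
move: uA; rewrite AE' !inE => /orP[]/eqP->; first by exists y.
by exists x; [rewrite adj_sym | rewrite setUC].
Qed.

(** Sending a neighbour [y] to [[set u; y]] is a bijection onto the edges at [u]. This lets degrees
    be compared with the sums over incident edges that define vertex weights. *)
Lemma deg_card_incident u : deg u = #|[set a : edge G | u \in val a]|.
Proof.
rewrite -(card_imset _ val_inj) /deg.
have inj : {in [set y | adj u y] &, injective (fun y => [set u; y])}.
  (* Testing the equality of the two pairs at [y] leaves [y = z] or [y = u]; the latter would make
     [u] adjacent to itself. *)
  move=> y z; rewrite !inE => uy _ /setP/(_ y).
  rewrite !inE eqxx orbT => /esym/orP[]/eqP// yu.
  by rewrite yu adj_irrefl in uy.
rewrite -(card_in_imset inj); apply: eq_card => A.
apply/imsetP/imsetP=> [[y]|[a]]; rewrite inE.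
  move=> uy ->.
  have yE : [set u; y] \in edges G.
    by rewrite inE; apply/existsP; exists u; apply/existsP; exists y; rewrite uy eqxx.
  by exists (Sub [set u; y] yE : edge G); rewrite ?SubK // inE SubK !inE eqxx.
by move=> /edge_endP[y uy aE] ->; exists y; rewrite ?inE.
Qed.

Lemma deg1_adj x y z : deg x = 1 -> adj x y -> adj x z -> z = y.
Proof.
move/eqP/cards1P=> [t tE] xy xz.
have: y \in [set t] by rewrite -tE inE.
have: z \in [set t] by rewrite -tE inE.
by rewrite !inE => /eqP-> /eqP->.
Qed.

(** If [y] had degree 1 too, no edge would leave [[set x; y]], so this pair would be a whole
    component, namely a $K_2$. *)
Lemma deg_pendant_neighbour x y :
  no_K2_component G -> deg x = 1 -> adj x y -> 1 < deg y.
Proof.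
move=> hK2 dx xy; rewrite ltnNge; apply/negP=> dy.
have yx : adj y x by rewrite adj_sym.
have dy1 : deg y = 1.
  apply/eqP; rewrite eqn_leq dy /=.
  by apply/card_gt0P; exists x; rewrite inE.
have cl : closed adj [set x; y].
  apply: intro_closed => [|u v uv]; first exact/sym_connect_sym/adj_sym.
  rewrite !inE => /orP[]/eqP uE; rewrite uE in uv.
    by rewrite (deg1_adj _ _ _ dx xy uv) eqxx orbT.
  by rewrite (deg1_adj _ _ _ dy1 yx uv) eqxx.
case/eqP: (hK2 _ _ xy); apply/setP=> z; rewrite [LHS]inE.
apply/idP/idP=> [/(closed_connect cl) <-|]; first by rewrite !inE eqxx.
by rewrite !inE => /orP[]/eqP->; [exact: connect0 | exact: connect1].
Qed.

(** Counting principle behind both lower bounds: the values of [g] on [A] together with the extra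
    value [v] form a duplicate-free list of weights. *)
Lemma num_weights_gt_card f (I : finType) (A : {set I}) (g : I -> nat) v :
    {in A &, injective g} -> {in A, forall i, g i \in codom (weight f)} ->
    v \in codom (weight f) -> {in A, forall i, g i <> v} ->
  #|A| < num_weights f.
Proof.
move=> injg gw vw gv; rewrite cardE -(size_map g).
apply: (@uniq_leq_size _ (v :: _)) => [|n].
  rewrite /= map_inj_in_uniq ?enum_uniq ?andbT; last first.
    by move=> i j; rewrite !mem_enum; apply: injg.
  by apply/mapP=> -[i]; rewrite mem_enum => /gv ne /esym.
rewrite mem_undup inE => /predU1P[-> //|/mapP[i]].
by rewrite mem_enum => /gw gi ->.
Qed.

Lemma deg_lt_num_weights f u :
  local_total_antimagic f -> deg u < num_weights f.
Proof.
case=> _ _ dEE dVE; rewrite deg_card_incident.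
apply: (@num_weights_gt_card f _ _ (fun a => weight f (inr a)) (weight f (inl u)));
  try by move=> *; apply: codom_f.
- move=> a b; rewrite !inE => ua ub; case: (eqVneq a b) => // ab eqw.
  case: (dEE a b) => //; rewrite /adjacent_edges ab.
  (* The common vertex [u] shows that the two edges are adjacent. *)
  by apply/pred0Pn; exists u; rewrite /= ua.
- by move=> a; rewrite inE => /dVE + /esym.
Qed.

Lemma label_gt0 f z : total_labeling f -> 0 < f z.
Proof. by case=> _ /(_ (f z))[_ /(_ (ex_intro _ z erefl)) /andP[]]. Qed.

Lemma weight_pendant f x a :
  deg x = 1 -> x \in val a -> weight f (inl x) = f (inr a).
Proof.
rewrite deg_card_incident => /eqP/cards1P[b bE] xa.
have : a \in [set b] by rewrite -bE inE.
rewrite inE => /eqP->.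
rewrite /= (eq_bigl (pred1 b)) ?big_pred1_eq // => c.
by move/setP/(_ c): bE; rewrite !inE.
Qed.

(** A second edge [b] at [y] adds a positive label to that of [a]. *)
Lemma label_lt_weight f y a :
  total_labeling f -> 1 < deg y -> y \in val a -> f (inr a) < weight f (inl y).
Proof.
move=> tf; rewrite deg_card_incident (cardsD1 a) inE => + ya.
rewrite ya ltnS => /card_gt0P[b]; rewrite !inE => /andP[ba yb] /=.
rewrite (bigD1 a) //= (bigD1 b) ?yb //= -addn1 leq_add2l.
exact: leq_trans (label_gt0 _ _ tf) (leq_addr _ _).
Qed.

(** Besides the pendant end, this provides the other end [y], whose weight will be the extra value
    in the count. *)
Lemma pendant_edgeP a :
  reflect (exists x, [/\ deg x = 1, x \in val a
                       & exists2 y, adj x y & y \in val a])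
          (a \in pendant_edges G).
Proof.
rewrite inE; apply: (iffP exists_inP) => [[x xa /eqP dx]|[x [dx xa _]]].
  exists x; split=> //; have [y xy ->] := edge_endP _ _ xa.
  by exists y; rewrite // !inE eqxx orbT.
by exists x => //; apply/eqP.
Qed.

Lemma card_pendant_lt_num_weights f :
    no_K2_component G -> local_total_antimagic f -> 0 < #|pendant_edges G| ->
  #|pendant_edges G| < num_weights f.
Proof.
move=> hK2 [tf _ _ _] /card_gt0P[a0 a0P].
pose a := [arg max_(b > a0 in pendant_edges G) f (inr b)].
have [aP amax] : a \in pendant_edges G /\
    {in pendant_edges G, forall b, f (inr b) <= f (inr a)}.
  by rewrite /a; case: arg_maxnP.
have [x [dx xa [y xy ya]]] := pendant_edgeP _ aP.
have lt_ay := label_lt_weight _ _ _ tf (deg_pendant_neighbour _ _ hK2 dx xy) ya.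
apply: (@num_weights_gt_card f _ _ (fun b => f (inr b)) (weight f (inl y))).
- by move=> b c _ _ /(proj1 tf) [].
- move=> b /pendant_edgeP[z [dz zb _]].
  by rewrite -(weight_pendant _ _ _ dz zb) codom_f.
- exact: codom_f.
(* Every pendant label is at most that of [a], hence below the weight of [y]. *)
- by move=> b /amax le_ba eq_by; rewrite -eq_by ltnNge le_ba in lt_ay.
Qed.

(** Gives the final bound by 3: the neighbour of a pendant vertex has degree at least 2. *)
Lemma max_deg_gt1 :
  no_K2_component G -> 0 < #|pendant_edges G| -> 1 < max_deg G.
Proof.
move=> hK2 /card_gt0P[a /pendant_edgeP[x [dx _ [y xy _]]]].
exact: leq_trans (deg_pendant_neighbour _ _ hK2 dx xy) (leq_bigmax y).
Qed.

End LowerBounds.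

Theorem corollary2p2 (G : sgraph) (k : nat)
  (hp : 3 <= #|G|) (hq : 2 <= #|edges G|)
  (hiso : no_isolated_vertex G) (hK2 : no_K2_component G)
  (hk : #|pendant_edges G| = k) (hk1 : 1 <= k) :
  [/\ chi_lt_ge G (maxn (max_deg G + 1) (k + 1)),
      forall c : nat, is_chi_lt G c -> maxn (max_deg G + 1) (k + 1) <= c
    & 3 <= maxn (max_deg G + 1) (k + 1)].
Proof.
have lb : chi_lt_ge G (maxn (max_deg G + 1) (k + 1)).
  move=> f ltf; rewrite geq_max !addn1 -hk.
  rewrite card_pendant_lt_num_weights ?hk // andbT.
  (* Nonemptiness ensures that the maximum degree is attained at some vertex. *)
  have G_gt0 : 0 < #|G| by apply: leq_trans hp.
  rewrite /max_deg; have [u ->] := eq_bigmax (@deg G) G_gt0.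
  exact: deg_lt_num_weights.
split=> // [c [[f ltf <-] _]|]; first exact: lb.
by rewrite leq_max !addn1 ltnS max_deg_gt1 ?hk.
Qed.
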